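(* Let $h>0$ be fixed and let $Y(t):[0,\infty)\to\mathbb R$ be a centered continuous Gaussian process with stationary increments, covariance function $R_Y(s,t)$ and variance function $V_Y(t)=R_Y(t,t)$, extended by $V_Y(t)=V_Y(-t)$ for $t\in(-\infty,0)$. Let $X_Y(t)=Y(t+h)-Y(t)$ denote the increment process, with covariance function $\Gamma(t-s)=R(s,t)=E[X_Y(s)X_Y(t)]$, and let $f_Y^h(t)=V_Y(t+h)-V_Y(t)$ be the increment function. Assume that: (i) $f_Y^h$ is $C^2((0,\infty),\mathbb R)$; (ii) $(f_Y^h)'(t)>0$ for all $t\in\mathbb R$; (iii) for all $\beta\in[0,h]$, $(f_Y^h)''(t)+(f_Y^h)''(t-\beta)<0$ for all $t\in[0,\infty)\setminus\{\beta\}$. Consider the interval $[a,b]$ with $b-a\le h$. Then the optimal measure associated to the optimization problem $$\sigma_\ast^2(a,b)=\inf_{\mu\in\mathcal M_1([a,b])}\int_a^b\int_a^b R(s,t)\,\mu(ds)\,\mu(dt)$$ is $$\mu^\ast=\frac12\left(\delta_a+\delta_b\right).$$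
   Context: $\mathcal M_1([a,b])$ denotes the space of Borel probability measures on $[a,b]$, and $\delta_x$ is the Dirac measure at $x$. An optimal measure for the problem $\sigma_\ast^2(a,b)$ is a measure $\mu^\ast\in\mathcal M_1([a,b])$ attaining the infimum.
   Formalization: The formal theorem assumes in addition Y(0)=0 almost surely (the claim fails without it), and requires (iii) only for t>0, t≠β, since at t=0, β=h it can never hold because V_Y is even. *)

(* Defs.v *)
From HB Require Import structures.
From mathcomp Require Import all_boot all_order all_algebra.
From mathcomp Require Import all_classical all_reals all_analysis.
From mathcomp Require Import measurable_realfun.

Set Implicit Arguments.
Unset Strict Implicit.
Unset Printing Implicit Defensive.

Import Order.TTheory GRing.Theory Num.Theory.
Import numFieldNormedType.Exports.

Local Open Scope classical_set_scope.
Local Open Scope ring_scope.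

(* A process on [0, +oo[ is a family indexed by all of R; only its values at
   times t >= 0 are ever constrained or used. *)
Section Processes.
Context {d : measure_display} {T : measurableType d} {R : realType}.
Variable P : probability T R.

(* [normal_prob m 0] is a junk value in the library, so the degenerate normal
   law is written as a Dirac mass. *)
Definition gaussian_rv (X : T -> R) : Prop :=
  exists m s : R, forall A : set R, measurable A ->
    P (X @^-1` A) = if s == 0 then \d_m A else normal_prob m s A.

Definition gaussian_process (Y : R -> {RV P >-> R}) : Prop :=
  forall (n : nat) (t c : 'I_n -> R), (forall i, 0 <= t i) ->
    gaussian_rv (fun w => \sum_(i < n) c i * Y (t i) w).

Definition centered (Y : R -> {RV P >-> R}) : Prop :=
  forall t : R, 0 <= t -> ('E_P[Y t] = 0)%E.

Definition continuous_paths (Y : R -> {RV P >-> R}) : Prop :=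
  {ae P, forall w, {within `[0, +oo[, continuous (fun t : R => Y t w)}}.

(* The finite-dimensional laws of (Y (u + t) - Y u)_t do not depend on u; laws
   on R^n are compared on measurable boxes. *)
Definition stationary_increments (Y : R -> {RV P >-> R}) : Prop :=
  forall (u : R) (n : nat) (t : 'I_n -> R) (A : 'I_n -> set R),
    0 <= u -> (forall i, 0 <= t i) -> (forall i, measurable (A i)) ->
    P (\bigcap_(i in [set: 'I_n]) [set w | A i (Y (u + t i) w - Y u w)]) =
    P (\bigcap_(i in [set: 'I_n]) [set w | A i (Y (t i) w - Y 0 w)]).

Definition covariance_function (Y : R -> {RV P >-> R}) (s t : R) : R :=
  fine (covariance P (Y s) (Y t)).

(* Even extension to R of t |-> covariance_function Y t t. When Y has stationary
   increments and Y 0 = 0 almost surely, it is also the variogram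
   V (t - s) = E[(Y t - Y s)^2], which ties it to the covariance of the
   increment process; without Y 0 = 0 that link is lost. *)
Definition variance_function (Y : R -> {RV P >-> R}) (t : R) : R :=
  covariance_function Y `|t| `|t|.

Definition increment_function (h : R) (Y : R -> {RV P >-> R}) (t : R) : R :=
  variance_function Y (t + h) - variance_function Y t.

Definition increment_process (h : R) (Y : R -> {RV P >-> R}) (t : R) (w : T) : R :=
  Y (t + h) w - Y t w.

Definition increment_covariance (h : R) (Y : R -> {RV P >-> R}) (s t : R) : R :=
  fine ('E_P[increment_process h Y s * increment_process h Y t])%E.

End Processes.

Section IncrementConditions.
Context {R : realType}.
Implicit Types (f : R -> R) (h : R).

Definition C2_on_positive f : Prop :=
  forall t : R, 0 < t ->
    [/\ derivable f t 1, derivable f^`()%classic t 1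
      & {for t, continuous f^`(2)%classic}].

Definition positive_derivative f : Prop :=
  forall t : R, derivable f t 1 /\ 0 < f^`()%classic t.

(* The second derivatives involved are part of the condition: [f^`(2)] is a
   total function and t - beta ranges over ]-h, +oo[.
   The time t = 0 is left out, as is t = beta, because f'' need not exist at 0.
   For f t = V (t + h) - V t with V even, f (- h - t) = - f t; so if f'' exists
   at 0, then f'' 0 + f'' (- h) = 0 and the inequality cannot hold for
   t = 0 and beta = h. *)
Definition paired_concavity h f : Prop :=
  forall beta : R, 0 <= beta <= h ->
  forall t : R, 0 < t -> t != beta ->
    [/\ derivable f^`()%classic t 1, derivable f^`()%classic (t - beta) 1
      & f^`(2)%classic t + f^`(2)%classic (t - beta) < 0].

End IncrementConditions.

Section Optimization.
Context {R : realType}.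

(* Borel probability measures on [a, b], as those on R carried by [a, b]. *)
Definition probability_on (a b : R) : set (probability (measurableTypeR R) R) :=
  [set mu : probability (measurableTypeR R) R | mu `[a, b]%classic = 1%E].

Definition energy (K : R -> R -> R) (a b : R)
    (mu : probability (measurableTypeR R) R) : \bar R :=
  (\int[mu]_(t in `[a, b]) \int[mu]_(s in `[a, b]) (K s t)%:E)%E.

Definition optimal_value (K : R -> R -> R) (a b : R) : \bar R :=
  ereal_inf (energy K a b @` probability_on a b).

Definition optimal_measure (K : R -> R -> R) (a b : R)
    (mu : probability (measurableTypeR R) R) : Prop :=
  probability_on a b mu /\ energy K a b mu = optimal_value K a b.

End Optimization.

Section HalfEndpoints.
Context {R : realType}.
Variables a b : R.

Definition half_endpoints (A : set (measurableTypeR R)) : \bar R :=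
  ((2^-1)%:E * (\d_a A + \d_b A))%E.

Let half_endpointsE : half_endpoints =
  mscale (2^-1)%:nng
    (measure_add (@dirac _ (measurableTypeR R) a R)
                 (@dirac _ (measurableTypeR R) b R)).
Proof.
by apply/funext => A; rewrite /mscale/= /msum 2!big_ord_recl/= big_ord0 adde0.
Qed.

Let half_endpoints0 : half_endpoints set0 = 0%E.
Proof. by rewrite half_endpointsE measure0. Qed.

Let half_endpoints_ge0 A : (0 <= half_endpoints A)%E.
Proof. by rewrite half_endpointsE measure_ge0. Qed.

Let half_endpoints_sigma_additive : semi_sigma_additive half_endpoints.
Proof. by rewrite half_endpointsE; exact: measure_semi_sigma_additive. Qed.

HB.instance Definition _ := isMeasure.Build _ (measurableTypeR R) R
  half_endpoints half_endpoints0 half_endpoints_ge0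
  half_endpoints_sigma_additive.

Let half_endpoints_setT : half_endpoints setT = 1%E.
Proof.
rewrite /half_endpoints !diracT -EFinD -EFinM.
by rewrite -[1 + 1]/(2%:R) mulVf// pnatr_eq0.
Qed.

HB.instance Definition _ := @Measure_isProbability.Build _ (measurableTypeR R) R
  half_endpoints half_endpoints_setT.

End HalfEndpoints.

(* Main.v *)
Require Import Defs.
From HB Require Import structures.
From mathcomp Require Import all_boot all_order all_algebra.
From mathcomp Require Import all_classical all_reals all_analysis.
From mathcomp Require Import measurable_realfun.
From mathcomp Require Import ring lra.

Set Implicit Arguments.
Unset Strict Implicit.
Unset Printing Implicit Defensive.

Import Order.TTheory GRing.Theory Num.Theory.
Import numFieldNormedType.Exports.

Local Open Scope classical_set_scope.
Local Open Scope ring_scope.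

(** Write [V] for the variance function, [f t = V (t + h) - V t], and
    [g u = (f u + f (- u)) / 2].  Stationarity of the increments and polarisation
    give E[(Y (s+h) - Y s) (Y (t+h) - Y t)] = g (t - s) for nonnegative [s], [t]
    ([increment_covarianceE]); the second moments exist because a normal law has
    one ([gaussian_Lfun2]).  Being a covariance, the kernel [g (t - s)] is positive
    semidefinite, and [g] is even and continuous.

    For such a kernel, let [mu0] be the half-endpoints measure, [phi] its potential
    and [c] the value of [phi] at [a] and [b], which is also the energy of [mu0].
    For every probability [mu] on [a, b], the energy of the signed measure
    [mu - mu0] is nonnegative ([energy_psd]), so the energy of [mu] is at least
    twice the integral of [phi] against [mu], minus [c].  Hence [mu0] is optimal as
    soon as [phi >= c] on [a, b]; and if [phi > c] inside, an optimal measure lives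
    on the two endpoints, where the strict inequality [g (b - a) < g 0] leaves only
    equal weights.

    Everything thus reduces to g 0 + g L < g x + g (L - x) for 0 < x < L = b - a
    ([folded_sum_gt_ends]).  The derivative of the right-hand side is
    (k x - k (L - x)) / 2, where k s = f' s + f' (s - L), and [k] decreases on
    ]0, L[ by the pairing condition on f'' with beta = L, available because
    L <= h. *)

(** * The potential of the two endpoints *)

Lemma is_derive1_comp_affine (R : realType) (f : R -> R) (e c x : R) :
  derivable f (e * x + c) 1 ->
  is_derive x 1 (fun u => f (e * u + c)) (e * f^`()%classic (e * x + c)).
Proof.
move=> fD; pose l u : R := e * u + c.
have lD : is_derive x 1 l e.
  by apply: is_derive_eq; rewrite /GRing.scale/=; ring.
have lD1 : derivable l x 1 by case: lD.
apply: DeriveDef.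
  apply/derivable1_diffP; apply: (@differentiable_comp _ _ _ _ l f).
    exact/derivable1_diffP.
  exact/derivable1_diffP.
rewrite -derive1E (@derive1_comp _ l f)// mulrC; congr (_ * _).
by rewrite derive1E derive_val.
Qed.

(** Why the potential of the two endpoints is smallest at the endpoints.  The
    symmetrised function [g] itself need not be concave on ]0, L[, only the sum
    [g x + g (L - x)] is under control: its derivative is [(k x - k (L - x)) / 2]
    with [k s = f' s + f' (s - L)], and the sign condition on
    [f'' s + f'' (s - L)] is that of [k'], so [k] decreases.  Hence the sum
    increases on [0, L / 2], and it is symmetric about [L / 2]. *)
Lemma folded_sum_gt_ends (R : realType) (f : R -> R) (L : R) :
  (forall t, derivable f t 1) ->
  (forall s, 0 < s < L ->
    [/\ derivable f^`()%classic s 1, derivable f^`()%classic (s - L) 1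
      & f^`(2)%classic s + f^`(2)%classic (s - L) < 0]) ->
  let g u := (f u + f (- u)) / 2 in
  forall x : R, 0 < x < L -> g 0 + g L < g x + g (L - x).
Proof.
move=> fD fC g.
(* The arguments are written as affine maps so that
   [is_derive1_comp_affine] applies to each term. *)
pose k s := f^`()%classic (1 * s + 0) + f^`()%classic (1 * s - L).
have kI (s : R) : 0 < s < L ->
    is_derive s 1 k (f^`(2)%classic s + f^`(2)%classic (s - L)).
  move=> /fC[d1 d2 _]; rewrite 2!derive1nS.
  have h1 := @is_derive1_comp_affine _ (f^`()%classic) 1 0 s.
  have h2 := @is_derive1_comp_affine _ (f^`()%classic) 1 (- L) s.
  rewrite mul1r addr0 in h1; rewrite mul1r in h2.
  by have := is_deriveD (h1 d1) (h2 d2); rewrite !mul1r.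
have k_decr u v : 0 < u -> u < v -> v < L -> k v < k u.
  move=> u0 uv vL.
  have D x : x \in `]0, L[ -> derivable k x 1.
    by rewrite in_itv/= => /kI[].
  apply: (@ltr0_derive1_lt_oo _ k 0 L) => //.
  - move=> x; rewrite in_itv/= => xL; have [_ kE] := kI x xL.
    by rewrite derive1E kE; case: (fC x xL).
  - by move=> x /set_mem/D/derivable1_diffP/differentiable_continuous.
  - by rewrite in_itv/= vL (lt_trans u0).
  - by rewrite in_itv/= u0 (lt_trans uv).
pose G x := f (1 * x + 0) + f (-1 * x + 0) + (f (-1 * x + L) + f (1 * x - L)).
have GE x : g x + g (L - x) = G x / 2.
  by rewrite /g /G !mul1r !addr0 mulN1r opprB (addrC _ L); lra.
have GI (x : R) : is_derive x 1 G (k x - k (L - x)).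
  have D e c := @is_derive1_comp_affine _ f e c x (fD _).
  apply: (is_derive_eq (is_deriveD (is_deriveD (D 1 0) (D (-1) 0))
    (is_deriveD (D (-1) L) (D 1 (- L))))).
  rewrite /k !mul1r !mulN1r !addr0.
  rewrite (_ : L - x - L = - x); last by ring.
  by rewrite (addrC _ L); ring.
have G_incr u v : 0 <= u -> u < v -> v <= L / 2 -> G u < G v.
  move=> u0 uv vL.
  apply: (@gtr0_derive1_lt_cc _ G 0 (L / 2)) => //.
  - move=> x; rewrite in_itv/= => /andP[x0 xL]; have [_ GE'] := GI x.
    by rewrite derive1E GE' subr_gt0; apply: k_decr; lra.
  - by apply: derivable_within_continuous => x _; case: (GI x).
  - by rewrite in_itv/= u0; lra.
  - by rewrite in_itv/= vL andbT; lra.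
move=> x /andP[x0 xL].
have -> : g 0 + g L = G 0 / 2 by rewrite -GE subr0.
wlog xL2 : x x0 xL / x <= L / 2.
  move=> wl; have [xL2|xL2] := leP x (L / 2); first exact: wl.
  have := wl (L - x); rewrite (_ : L - (L - x) = x); last by ring.
  by rewrite [X in _ -> _ < X]addrC; apply; lra.
by rewrite GE ltr_pM2r ?invr_gt0//; exact: G_incr.
Qed.

(** * Integrals of continuous functions on a segment *)

Section ContinuousIntegrals.
Context {R : realType}.
Implicit Types (phi : R -> R) (mu : probability (measurableTypeR R) R).

(** Uniform continuity on [-M, M], in the one-sided form needed below: only one
    of the two points has to lie in the compact set. *)
Lemma uniform_modulus phi (M e : R) : continuous phi -> 0 < e ->
  exists2 dlt : R, 0 < dlt &
    forall s t, `|s| <= M -> `|s - t| <= dlt -> `|phi s - phi t| <= e.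
Proof.
move=> cphi e0.
have /compact_near_coveringP near_cov := @segment_compact R (- M) M.
have [|r /= r0 Hr] := near_cov R (0^'+) (fun dlt s =>
  forall t, `|s - t| <= dlt -> `|phi s - phi t| <= e) _.
  move=> x _.
  have e20 : 0 < e / 2 by rewrite divr_gt0.
  have /cvgrPdist_lt/(_ _ e20)/nbhs_ballP[r /= r0 Hr] := cphi x.
  exists (ball x (r / 2), [set dlt | dlt < r / 2]) => /=.
    split; first by apply: nbhsx_ballx; rewrite divr_gt0.
    by apply: nbhs_right_lt; rewrite divr_gt0.
  move=> [s dlt] /= []; rewrite /ball/= => xs dr t st.
  rewrite (_ : phi s - phi t = (phi x - phi t) - (phi x - phi s)); last by ring.
  have h1 : `|phi x - phi s| < e / 2.
    by apply: Hr; rewrite /ball/=; lra.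
  have h2 : `|phi x - phi t| < e / 2.
    apply: Hr; rewrite /ball/= (_ : x - t = (x - s) + (s - t)); last by ring.
    by rewrite (le_lt_trans (ler_normD _ _))//; lra.
  by rewrite (le_trans (ler_normB _ _))//; lra.
exists (r / 2); first by rewrite divr_gt0.
move=> s t sM; apply: (Hr (r / 2)) => /=.
- by rewrite sub0r normrN gtr0_norm ?divr_gt0//; lra.
- by rewrite divr_gt0.
- by rewrite in_itv/= -ler_norml.
Qed.

Lemma continuous_integrable_itv phi mu a b : continuous phi ->
  mu.-integrable `[a, b] (EFin \o phi).
Proof.
move=> cphi; apply: measurable_bounded_integrable => //.
- by rewrite (le_lt_trans (probability_le1 _ _)) ?ltry.
- by apply: measurable_funTS; exact: continuous_measurable_fun.
- have := @segment_compact R a b.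
  have cw : {within `[a, b], continuous phi} by exact: continuous_subspaceT.
  move=> /(continuous_compact cw)/compact_bounded[M [_ mrt]].
  by exists M; split; rewrite ?num_real // => ? ? ? ?; exact: mrt.
Qed.

Lemma Rintegral_sum d (T : measurableType d) (m : {measure set T -> \bar R})
    (D : set T) (I : Type) (s : seq I) (f : I -> T -> R) :
  measurable D -> (forall i, m.-integrable D (EFin \o f i)) ->
  \int[m]_(x in D) (\sum_(i <- s) f i x) = \sum_(i <- s) \int[m]_(x in D) f i x.
Proof.
move=> mD fi; rewrite /Rintegral.
under eq_integral do rewrite -sumEFin.
rewrite integral_sum// -sum_fine// => i _.
exact: integrable_fin_num (fi i).
Qed.

End ContinuousIntegrals.

Section Quantization.
Context {R : realType}.
Implicit Types (phi psi : R -> R) (mu : probability (measurableTypeR R) R).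

Lemma Rintegral_cst_itv mu a b (k : R) :
  mu `[a, b]%classic = 1%E -> \int[mu]_(t in `[a, b]) k = k.
Proof.
move=> mu1; rewrite Rintegral_cst// -[RHS]mulr1; congr (_ * _).
exact: (congr1 fine mu1).
Qed.

Lemma integrable_cst_itv mu a b (k : R) : mu.-integrable `[a, b] (EFin \o cst k).
Proof. by apply: continuous_integrable_itv => x; exact: cvg_cst. Qed.

Lemma Rintegral_dist_le mu a b phi psi e :
  mu `[a, b]%classic = 1%E ->
  mu.-integrable `[a, b] (EFin \o phi) -> mu.-integrable `[a, b] (EFin \o psi) ->
  (forall t, a <= t <= b -> `|phi t - psi t| <= e) ->
  `|\int[mu]_(t in `[a, b]) phi t - \int[mu]_(t in `[a, b]) psi t| <= e.
Proof.
move=> mu1 iphi ipsi dist; rewrite -RintegralB//.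
have iB : mu.-integrable `[a, b] (EFin \o (fun t => phi t - psi t)).
  exact: (integrableB _ iphi ipsi).
rewrite (le_trans (le_normr_Rintegral _ iB))// -[leRHS](@Rintegral_cst_itv mu a b)//.
by apply: le_Rintegral => //; [exact: integrable_norm|exact: integrable_cst_itv].
Qed.

(** The discretisation of [mu] to a grid of step [dlt].  It is chosen before
    the test function, so that the same points and weights approximate the
    energy, the potential and the integral of any other continuous function;
    this is what transfers inequalities from finite sums to integrals.  An entry
    of the sequence is a pair (weight, point). *)
Lemma quantization mu a b dlt : a <= b -> 0 < dlt ->
  mu `[a, b]%classic = 1%E ->
  exists s : seq (R * R),
    [/\ forall u, u \in s -> 0 <= u.1 /\ a <= u.2 <= b,
        \sum_(u <- s) u.1 = 1
      & forall phi e, continuous phi ->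
          (forall x t, a <= x <= b -> a <= t <= b -> `|x - t| <= dlt ->
             `|phi x - phi t| <= e) ->
          `|\int[mu]_(t in `[a, b]) phi t - \sum_(u <- s) u.1 * phi u.2| <= e].
Proof.
move=> ab dlt0 mu1.
pose N := (Num.truncn ((b - a) / dlt)).+1.
pose x (i : nat) := a + i%:R * dlt.
pose A i : set (measurableTypeR R) := `[x i, x i.+1[%classic.
pose s := [seq (fine (mu (A i `&` `[a, b]%classic)), x i) | i <- iota 0 N].
have approx phi e : continuous phi ->
    (forall x t, a <= x <= b -> a <= t <= b -> `|x - t| <= dlt ->
       `|phi x - phi t| <= e) ->
    `|\int[mu]_(t in `[a, b]) phi t - \sum_(u <- s) u.1 * phi u.2| <= e.
  move=> cphi osc.
  have mA i : measurable (A i) by exact: measurable_itv.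
  have iA i : mu.-integrable `[a, b] (EFin \o (\1_(A i) : R -> R)).
    by apply: (@integrableS _ _ _ _ setT) => //; exact: integrable_indic.
  have iAphi i : mu.-integrable `[a, b] (EFin \o (fun t => phi (x i) * \1_(A i) t)).
    exact: (integrableZl _ (phi (x i)) (iA i)).
  rewrite big_map.
  have -> : \sum_(i <- iota 0 N) fine (mu (A i `&` `[a, b]%classic)) * phi (x i) =
      \int[mu]_(t in `[a, b]) \sum_(i <- iota 0 N) phi (x i) * \1_(A i) t.
    rewrite Rintegral_sum//; apply: eq_bigr => i _.
    by rewrite RintegralZl// mulrC /Rintegral integral_indic.
  apply: Rintegral_dist_le => //.
  - exact: continuous_integrable_itv.
  - rewrite (_ : _ \o _ =
      (fun t => \sum_(i <- iota 0 N) (phi (x i) * \1_(A i) t)%:E)%E).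
      by apply: integrable_sum => // i _; exact: iAphi.
    by apply/funext => t /=; rewrite sumEFin.
  (* At [t] the step function takes the value of [phi] at the left end of the
     cell containing [t]. *)
  move=> t /andP[ta tb].
  pose i0 := Num.truncn ((t - a) / dlt).
  have ta0 : 0 <= (t - a) / dlt by rewrite divr_ge0 ?subr_ge0// ltW.
  have i0N : i0 \in iota 0 N.
    rewrite mem_iota add0n ltnS /= truncn_ge_nat; last first.
      by rewrite divr_ge0 ?subr_ge0// ltW.
    rewrite (le_trans (proj1 (andP (truncn_itv ta0))))//.
    by rewrite ler_pM2r ?invr_gt0// lerB.
  have memA i : (t \in A i) = (i == i0).
    apply/idP/eqP.
      move=> /set_mem; rewrite /A/= in_itv/= /x => /andP[h1 h2]; apply/esym/truncn_def.
      by rewrite ler_pdivlMr// ltr_pdivrMr//; apply/andP; split; lra.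
    move=> ->; apply/mem_set; rewrite /A/= in_itv/= /x.
    have := truncn_itv ta0; rewrite ler_pdivlMr// ltr_pdivrMr// => /andP[h1 h2].
    by apply/andP; split; lra.
  rewrite (bigD1_seq i0) ?iota_uniq//= indicE memA eqxx mulr1 big1 ?addr0; last first.
    by move=> i /negPf ii0; rewrite indicE memA ii0 mulr0.
  have /set_mem : t \in A i0 by rewrite memA eqxx.
  rewrite /A/= in_itv/= => /andP[h1 h2].
  apply: osc; first by rewrite ta tb.
    by rewrite (le_trans h1 tb) /x lerDl mulr_ge0// ltW.
  by move: h2; rewrite ger0_norm ?subr_ge0// /x -natr1; lra.
exists s; split => //.
  move=> u /mapP[i]; rewrite mem_iota add0n ltnS => /andP[_ iN] -> /=.
  rewrite fine_ge0//; split=> //; rewrite /x lerDl mulr_ge0 ?(ltW dlt0)//=.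
  rewrite -lerBrDl -ler_pdivlMr// -truncn_ge_nat//.
  by rewrite divr_ge0 ?subr_ge0// ltW.
(* The total weight is the approximation of the integral of the constant 1,
   which has oscillation 0. *)
have osc1 x' t : a <= x' <= b -> a <= t <= b -> `|x' - t| <= dlt ->
    `|(cst 1 : R -> R) x' - (cst 1 : R -> R) t| <= 0.
  by move=> *; rewrite subrr normr0.
have cst_cont : continuous (cst 1 : R -> R) by move=> ?; exact: cvg_cst.
have := approx (cst 1) 0 cst_cont osc1.
rewrite normr_le0 subr_eq0 Rintegral_cst_itv// => /eqP ->.
by apply: eq_bigr => u _; rewrite mulr1.
Qed.

End Quantization.

(** * Measures carried by two points *)

Section TwoPoint.
Context {R : realType}.
Implicit Types (phi psi : R -> R) (mu : probability (measurableTypeR R) R).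

Lemma Rintegral_two_point mu (a b p q : R) phi :
  a <= b -> 0 <= p -> 0 <= q -> p + q = 1 ->
  (forall A, measurable A -> mu A = (p%:E * \d_a A + q%:E * \d_b A)%E) ->
  continuous phi ->
  \int[mu]_(t in `[a, b]) phi t = p * phi a + q * phi b.
Proof.
move=> ab p0 q0 pq1 muE cphi.
have aI : a \in [set` `[a, b]%R] by rewrite inE/= in_itv/= lexx ab.
have bI : b \in [set` `[a, b]%R] by rewrite inE/= in_itv/= lexx ab.
have mu1 : mu `[a, b]%classic = 1%E.
  by rewrite muE// !diracE aI bI -!EFinM -EFinD !mulr1 pq1.
have [c cab cmin] : exists2 c, c \in `[a, b]%R &
    forall t, t \in `[a, b]%R -> phi c <= phi t.
  by apply: EVT_min => //; exact: continuous_subspaceT.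
(* Integrals against scaled measures are computed for nonnegative functions, so
   [phi] is shifted by its minimum. *)
pose psi t := phi t - phi c.
have cpsi : continuous psi.
  by move=> t; apply: cvgB; [exact: cphi|exact: cvg_cst].
have mpsi : measurable_fun `[a, b] (EFin \o psi).
  by apply/measurable_EFinP/measurable_funTS; exact: continuous_measurable_fun.
have psi0 t : `[a, b]%classic t -> (0 <= (psi t)%:E)%E.
  by move=> tab; rewrite lee_fin subr_ge0 cmin.
have : (\int[mu]_(t in `[a, b]) (psi t)%:E = (p * psi a + q * psi b)%:E)%E.
  pose nu := measure_add (mscale (NngNum p0) (@dirac _ (measurableTypeR R) a R))
                         (mscale (NngNum q0) (@dirac _ (measurableTypeR R) b R)).
  rewrite (eq_measure_integral nu); last first.
    move=> A mA _; refine (etrans (muE A mA) _); symmetry.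
    exact: measure_addE.
  rewrite ge0_integral_measure_add// !ge0_integral_mscale//=.
  by rewrite !integral_dirac// !diracE aI bI !mul1e.
move=> /(congr1 fine) /=; rewrite -/(Rintegral _ _ _) /psi RintegralB//; first last.
- exact: integrable_cst_itv.
- exact: continuous_integrable_itv.
rewrite Rintegral_cst_itv// => /eqP; rewrite subr_eq => /eqP ->.
have -> : q = 1 - p by rewrite -pq1 addrC addKr.
by ring.
Qed.

Lemma carried_by_endpoints mu (a b : R) :
  a < b -> mu `[a, b]%classic = 1%E -> mu `]a, b[%classic = 0%E ->
  exists p q : R, [/\ 0 <= p, 0 <= q, p + q = 1 &
    forall A, measurable A -> mu A = (p%:E * \d_a A + q%:E * \d_b A)%E].
Proof.
move=> ab mu1 muo.
pose ends : set (measurableTypeR R) := [set a] `|` [set b].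
have m1 (x : R) : measurable ([set x] : set (measurableTypeR R)) by exact: measurable_set1.
have mends : measurable ends by exact: measurableU.
have muends : mu (~` ends) = 0%E.
  apply/eqP; rewrite eq_le measure_ge0 andbT.
  have -> : 0%E = (mu (~` `[a, b]%classic) + mu `]a, b[%classic)%E.
    by rewrite muo adde0 probability_setC// mu1 subee.
  rewrite (le_trans _ (measureU2 _ _ _))//; last exact: measurableC.
  apply: le_measure; rewrite ?inE//=; [exact: measurableC| |].
    by apply: measurableU => //; exact: measurableC.
  move=> t /= /not_orP[ta tb].
  have [tab|tab] := boolP (t \in `[a, b]%R); last by left; exact/negP.
  right; move: tab; rewrite /= !in_itv/= => /andP[at_ tb_].
  by rewrite !lt_neqAle at_ tb_ !andbT; apply/andP; split; apply/eqP => // /esym.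
have muA A : measurable A -> mu A = (mu [set a] * \d_a A + mu [set b] * \d_b A)%E.
  move=> mA.
  have -> : mu A = mu (A `&` ends).
    apply/eqP; rewrite eq_le; apply/andP; split; last first.
      by apply: le_measure; rewrite ?inE//; exact: measurableI.
    rewrite -[leRHS]adde0 -muends.
    rewrite (le_trans _ (measureU2 _ _ _))//; [|exact: measurableI|exact: measurableC].
    apply: le_measure; rewrite ?inE//.
      by apply: measurableU; [exact: measurableI|exact: measurableC].
    by move=> t At; have [|] := pselect (ends t); [left|right].
  rewrite /ends setIUr measureU//; [|exact: measurableI|exact: measurableI|]; last first.
    by apply/seteqP; split => // t /= [[_ ->] [_ /eqP]]; rewrite lt_eqF.
  have one (x : R) : mu (A `&` [set x]) = (mu [set x] * \d_x A)%E.
    rewrite diracE; have [xA|xA] := boolP (x \in A).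
      by rewrite mule1 setIidr// => _ ->; exact: set_mem.
    rewrite mule0 (_ : A `&` _ = set0) ?measure0//.
    by apply/seteqP; split => // t [At tx]; move: xA; rewrite -tx notin_setE; exact.
  exact: (f_equal2 adde (one a) (one b)).
have fin (x : R) : (fine (mu [set x]))%:E = mu [set x] by rewrite fineK// fin_num_measure.
exists (fine (mu [set a])), (fine (mu [set b])); split.
- exact/fine_ge0/measure_ge0.
- exact/fine_ge0/measure_ge0.
- apply: EFin_inj; rewrite EFinD !fin.
  by have := muA _ measurableT; rewrite !diracT !mule1 probability_setT.
- by move=> A mA; rewrite !fin; exact: muA.
Qed.

End TwoPoint.

(** * Energy minimisation for a positive semidefinite kernel *)

Section Optimality.
Context {R : realType}.
Variables (g : R -> R) (a b : R).
Hypothesis le_ab : a <= b.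
Hypothesis g_continuous : continuous g.
Hypothesis g_even : forall u, g (- u) = g u.
Hypothesis g_psd : forall s : seq (R * R), (forall u, u \in s -> a <= u.2 <= b) ->
  0 <= \sum_(u <- s) \sum_(v <- s) u.1 * v.1 * g (u.2 - v.2).
Implicit Types mu : probability (measurableTypeR R) R.

Let potential mu t := \int[mu]_(s in `[a, b]) g (t - s).

Let norm_itv (x : R) : a <= x <= b -> `|x| <= `|a| + `|b|.
Proof.
move=> /andP[ax xb]; rewrite ler_norml; have := ler_norm b; have := ler_norm (- a).
by have := normr_ge0 a; have := normr_ge0 b; rewrite normrN; lra.
Qed.

Let g_shift (t : R) : continuous (fun s => g (t - s)).
Proof.
move=> s; apply: continuous_comp; last exact: g_continuous.
by apply: cvgB => //; exact: cvg_cst.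
Qed.

Let g_shiftr (s : R) : continuous (fun t => g (t - s)).
Proof.
move=> t; apply: continuous_comp; last exact: g_continuous.
by apply: cvgB => //; exact: cvg_cst.
Qed.

Let potential_oscillation mu (M e dlt : R) : mu `[a, b]%classic = 1%E ->
  (forall s t, `|s| <= M -> `|s - t| <= dlt -> `|g s - g t| <= e) ->
  forall x t, `|x| + `|a| + `|b| <= M -> `|x - t| <= dlt ->
    `|potential mu x - potential mu t| <= e.
Proof.
move=> mu1 osc x t xM xt; apply: Rintegral_dist_le => //.
- exact: continuous_integrable_itv.
- exact: continuous_integrable_itv.
move=> s /andP[as_ sb]; apply: osc; last by rewrite opprB addrA subrK.
rewrite (le_trans (ler_normB _ _))// (le_trans _ xM)// -addrA lerD2l.
by rewrite norm_itv// as_.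
Qed.

Let potential_continuous mu : mu `[a, b]%classic = 1%E -> continuous (potential mu).
Proof.
move=> mu1 x; apply/cvgrPdist_le => e e0.
have [dlt dlt0 osc] := uniform_modulus (`|x| + `|a| + `|b|) g_continuous e0.
exists dlt => //= t; rewrite /ball/= => /ltW xt.
exact: (potential_oscillation mu1 osc).
Qed.

(** Both integrands are continuous, the outer one by uniform continuity of [g],
    so both integrals are finite and can be computed in [R]. *)
Lemma energyE mu : mu `[a, b]%classic = 1%E ->
  energy (fun s t => g (t - s)) a b mu = (\int[mu]_(t in `[a, b]) potential mu t)%:E.
Proof.
move=> mu1; rewrite /energy.
transitivity (\int[mu]_(t in `[a, b]) (potential mu t)%:E)%E.
  apply: eq_integral => t _; rewrite /potential fineK//.
  by apply: integrable_fin_num => //; exact: continuous_integrable_itv.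
rewrite fineK//; apply: integrable_fin_num => //.
exact/continuous_integrable_itv/potential_continuous.
Qed.

Let g_max x y : a <= x <= b -> a <= y <= b -> g (x - y) <= g 0.
Proof.
move=> xI yI; have wI (u : R * R) : u \in [:: (1, x); (-1, y)] -> a <= u.2 <= b.
  by rewrite !inE => /orP[]/eqP ->.
have := g_psd wI.
by rewrite !big_cons !big_nil/= !subrr -(opprB x y) g_even; lra.
Qed.

(** The potential of the half-endpoints measure, written with both differences
    nonnegative on [a, b]. *)
Let phi t := (g (t - a) + g (b - t)) / 2.

Let phi_continuous : continuous phi.
Proof.
move=> t; apply: cvgM; last exact: cvg_cst.
by apply: cvgD; [exact: g_shiftr|exact: g_shift].
Qed.

(** The common value of [phi] at both endpoints, and the energy of the
    half-endpoints measure. *)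
Let c := (g 0 + g (b - a)) / 2.

(** The energy of the signed measure [mu - half_endpoints a b] is nonnegative.
    Positive semidefiniteness is known for finite sums only: replace [mu] by its
    grid discretisation, apply it to the weighted grid points together with [a]
    and [b], each of weight -1/2, and let the step go to 0. *)
Lemma energy_psd mu : mu `[a, b]%classic = 1%E ->
  0 <= \int[mu]_(t in `[a, b]) potential mu t -
    2 * \int[mu]_(t in `[a, b]) phi t + c.
Proof.
move=> mu1.
(* Four errors of size [e]: two in the double integral, and one in the integral
   of [phi], which counts twice. *)
suff approx e : 0 < e ->
  - (4 * e) <= \int[mu]_(t in `[a, b]) potential mu t -
    2 * \int[mu]_(t in `[a, b]) phi t + c.
  apply/ler_addgt0Pr => e e0; have := approx (e / 4).
  by rewrite divr_gt0// => /(_ isT); lra.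
move=> e0.
pose M := `|a| + `|b| + `|a| + `|b|.
have [dlt dlt0 osc] := uniform_modulus M g_continuous e0.
have [s [sI s1 quant]] := quantization le_ab dlt0 mu1.
have normB x y : a <= x <= b -> a <= y <= b -> `|x - y| <= M.
  move=> /norm_itv hx /norm_itv hy; rewrite (le_trans (ler_normB _ _))// /M; lra.
have aI : a <= a <= b by rewrite lexx.
have bI : a <= b <= b by rewrite lexx le_ab.
(* The potential of the discretised measure. *)
pose K x := \sum_(u <- s) u.1 * g (x - u.2).
have potential_quant x : a <= x <= b -> `|potential mu x - K x| <= e.
  move=> xI; apply: (quant (fun t => g (x - t))) => // y t yI tI yt.
  apply: osc; first exact: normB.
  by rewrite (_ : x - y - (x - t) = - (y - t)) ?normrN//; ring.
have energy_quant : `|\int[mu]_(t in `[a, b]) potential mu t -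
    \sum_(u <- s) u.1 * potential mu u.2| <= e.
  apply: quant; first exact: potential_continuous.
  move=> x t xI tI xt; apply: (potential_oscillation mu1 osc) => //.
  by rewrite /M -addrA -[leRHS]addrA lerD2r norm_itv.
have phi_quant : `|\int[mu]_(t in `[a, b]) phi t - \sum_(u <- s) u.1 * phi u.2| <= e.
  apply: quant; first exact: phi_continuous.
  move=> x t xI tI xt; rewrite /phi.
  have h1 : `|g (x - a) - g (t - a)| <= e.
    by apply: osc; [exact: normB|rewrite (_ : x - a - (t - a) = x - t)//; ring].
  have h2 : `|g (b - x) - g (b - t)| <= e.
    apply: osc; first exact: normB.
    by rewrite (_ : b - x - (b - t) = - (x - t)) ?normrN//; ring.
  by move: h1 h2; rewrite !ler_norml => /andP[? ?] /andP[? ?]; apply/andP; split; lra.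
have quant_ge : \sum_(u <- s) u.1 * potential mu u.2 >=
    \sum_(u <- s) u.1 * K u.2 - e.
  rewrite lerBlDr -[e in leRHS]mul1r -s1 mulr_suml -big_split/=.
  rewrite big_seq [leRHS]big_seq; apply: ler_sum => u us; have [u0 uI] := sI u us.
  rewrite -mulrDr ler_wpM2l//.
  by have := potential_quant _ uI; rewrite ler_norml => /andP[]; lra.
have psd : 0 <= \sum_(u <- s) u.1 * K u.2 - 2 * \sum_(u <- s) u.1 * phi u.2 + c.
  have /g_psd : forall u, u \in s ++ [:: (- 2^-1, a); (- 2^-1, b)] -> a <= u.2 <= b.
    move=> u; rewrite mem_cat !inE => /orP[/sI[]//|/orP[]/eqP -> //=].
  set w := s ++ _.
  have row u : \sum_(v <- w) u.1 * v.1 * g (u.2 - v.2) = u.1 * K u.2 - u.1 * phi u.2.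
    rewrite /w big_cat !big_cons big_nil /= /K mulr_sumr /phi -(opprB u.2 b) g_even.
    by under eq_bigr do rewrite -mulrA; field.
  have KaKb : K a + K b = 2 * \sum_(u <- s) u.1 * phi u.2.
    rewrite /K -big_split mulr_sumr; apply: eq_bigr => u _ /=.
    by rewrite /phi -(opprB u.2 a) g_even; field.
  under eq_bigr do rewrite row.
  have pa : phi a = c by rewrite /phi subrr.
  have pb : phi b = c by rewrite /phi subrr addrC.
  rewrite /w big_cat !big_cons big_nil /= sumrB pa pb; lra.
move: energy_quant phi_quant; rewrite !ler_norml => /andP[h1 h2] /andP[h3 h4]; lra.
Qed.

Hypothesis g_ends : forall x, a < x < b -> g 0 + g (b - a) < g (x - a) + g (b - x).

Let phi_gt x : a < x < b -> c < phi x.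
Proof. by move=> /g_ends; rewrite /c /phi; lra. Qed.

Let phi_ge x : a <= x <= b -> c <= phi x.
Proof.
move=> /andP[]; rewrite le_eqVlt => /predU1P[<- _|ax].
  by rewrite /c /phi subrr.
rewrite le_eqVlt => /predU1P[->|xb]; first by rewrite /c /phi subrr addrC.
by apply/ltW/phi_gt; rewrite ax xb.
Qed.

Lemma energy_two_point mu (p q : R) : 0 <= p -> 0 <= q -> p + q = 1 ->
  (forall A, measurable A -> mu A = (p%:E * \d_a A + q%:E * \d_b A)%E) ->
  mu `[a, b]%classic = 1%E ->
  \int[mu]_(t in `[a, b]) potential mu t =
    (p ^+ 2 + q ^+ 2) * g 0 + 2 * p * q * g (b - a).
Proof.
move=> p0 q0 pq1 muE mu1; rewrite (Rintegral_two_point le_ab p0 q0 pq1 muE); last first.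
  exact: potential_continuous.
rewrite /potential !(Rintegral_two_point le_ab p0 q0 pq1 muE)//.
by rewrite !subrr -(opprB b a) g_even; ring.
Qed.

Let halfE A : measurable A ->
  half_endpoints a b A = ((2^-1)%:E * \d_a A + (2^-1)%:E * \d_b A)%E.
Proof. by move=> _; rewrite /half_endpoints ge0_muleDr. Qed.

Let half1 : half_endpoints a b `[a, b]%classic = 1%E.
Proof.
rewrite /half_endpoints !diracE !mem_set/= ?in_itv/= ?lexx ?le_ab//.
by rewrite -EFinD -EFinM -[1 + 1]/(2%:R) mulVf.
Qed.

Lemma energy_half :
  energy (fun s t => g (t - s)) a b (half_endpoints a b) = c%:E.
Proof.
rewrite energyE; last exact: half1.
rewrite (@energy_two_point _ 2^-1 2^-1); first by congr EFin; rewrite /c; lra.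
- by rewrite invr_ge0.
- by rewrite invr_ge0.
- by lra.
- exact: halfE.
- exact: half1.
Qed.

Let phi_int mu : mu `[a, b]%classic = 1%E -> c <= \int[mu]_(t in `[a, b]) phi t.
Proof.
move=> mu1; rewrite -[leLHS](@Rintegral_cst_itv _ mu a b)//.
apply: le_Rintegral => //.
- exact: integrable_cst_itv.
- exact: continuous_integrable_itv.
Qed.

(** [energy_psd] bounds the energy of [mu] below by twice the integral of [phi]
    minus [c]; since [phi] is at least [c] on [a, b], this is at least [c]. *)
Lemma half_endpoints_optimal :
  optimal_measure (fun s t => g (t - s)) a b (half_endpoints a b).
Proof.
split; first exact: half1.
rewrite energy_half; apply/eqP; rewrite eq_le; apply/andP; split; last first.
  apply: ereal_inf_lbound; exists (half_endpoints a b); [exact: half1|exact: energy_half].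
apply: le_ereal_inf_tmp => _ [mu mu1 <-]; rewrite energyE// lee_fin.
by have := energy_psd mu1; have := phi_int mu1; lra.
Qed.

(** Equality in the previous bound forces [phi = c] almost everywhere, hence no
    mass in ]a, b[ where [phi] is larger.  The energy of [p \d_a + q \d_b] is
    then [c + 2 (p - 1/2)^2 (g 0 - g (b - a))], so [p = 1/2] as soon as
    [g (b - a) < g 0].  If that inequality failed, the hypothesis on ]a, b[ would
    make [2 g 0] less than a sum of two values of [g] at differences of points of
    [a, b], each at most [g 0] by positive semidefiniteness for two points. *)
Lemma optimal_measure_unique mu :
  optimal_measure (fun s t => g (t - s)) a b mu ->
  forall A, measurable A -> mu A = half_endpoints a b A.
Proof.
move=> [mu1]; rewrite -(proj2 half_endpoints_optimal) energy_half energyE//.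
move=> E0; have muc := EFin_inj E0.
have phic : \int[mu]_(t in `[a, b]) phi t = c.
  by apply/eqP; rewrite eq_le phi_int// andbT; have := energy_psd mu1; lra.
have muo : mu `]a, b[%classic = 0%E.
  have idiff : mu.-integrable `[a, b] (EFin \o (fun t => phi t - c)).
    apply: continuous_integrable_itv => t.
    by apply: cvgB; [exact: phi_continuous|exact: cvg_cst].
  have : (\int[mu]_(t in `[a, b]) `|(phi t - c)%:E| = 0)%E.
    rewrite -[RHS](_ : (\int[mu]_(t in `[a, b]) (phi t - c))%:E = 0%E); last first.
      rewrite RintegralB ?phic ?Rintegral_cst_itv ?subrr//.
        exact: continuous_integrable_itv.
      exact: integrable_cst_itv.
    rewrite fineK; last exact: integrable_fin_num idiff.
    apply: eq_integral => t /set_mem/=; rewrite in_itv/= => tab.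
    by rewrite ger0_norm// subr_ge0 phi_ge.
  move/(ae_eq_integral_abs mu (measurable_itv _) (measurable_int _ idiff)).
  case=> N [mN N0 sub]; apply: (subset_measure0 _ mN _ N0) => //.
  move=> t /=; rewrite in_itv/= => /andP[at_ tb]; apply: sub => /=.
  rewrite in_itv/= (ltW at_) (ltW tb) => /(_ isT) E1.
  by have /eqP := EFin_inj E1; rewrite subr_eq0 gt_eqF// phi_gt// at_.
move: le_ab; rewrite le_eqVlt => /predU1P[ab|ab].
  have mua : mu [set a] = 1%E by rewrite -mu1 -ab set_itv1.
  have ma : measurable ([set a] : set (measurableTypeR R)) by exact: measurable_set1.
  move=> A mA; rewrite /half_endpoints -ab diracE.
  have [aA|aA] := boolP (a \in A).
    rewrite -EFinD -EFinM -[1 + 1]/(2%:R) mulVf//; apply/eqP.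
    rewrite eq_le probability_le1//= -mua.
    by apply: le_measure; rewrite ?inE// => _ ->; exact: set_mem.
  have muac : mu (~` [set a]) = 0%E by rewrite probability_setC// mua subee.
  rewrite adde0 mule0; apply: (subset_measure0 mA (measurableC ma) _ muac).
  by move=> t At ta; move: aA; rewrite -ta mem_set.
have [p [q [p0 q0 pq1 muE]]] := carried_by_endpoints ab mu1 muo.
move: muc; rewrite (energy_two_point p0 q0 pq1 muE)// => /eqP.
rewrite -subr_eq0.
have -> : (p ^+ 2 + q ^+ 2) * g 0 + 2 * p * q * g (b - a) - c =
    2 * (p - 2^-1) ^+ 2 * (g 0 - g (b - a)).
  by rewrite /c (_ : q = 1 - p); [field|rewrite -pq1 addrC addKr].
have g0L : 0 < g 0 - g (b - a).
  have mI : a < (a + b) / 2 < b by rewrite midf_lt// midf_lt.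
  have aI : a <= a <= b by rewrite lexx ltW.
  have bI : a <= b <= b by rewrite lexx ltW.
  have xI : a <= (a + b) / 2 <= b by case/andP: mI => *; rewrite !ltW.
  by have := g_ends mI; have := g_max xI aI; have := g_max bI xI; lra.
rewrite mulf_eq0 (gt_eqF g0L) orbF mulf_eq0 pnatr_eq0/= sqrf_eq0 subr_eq0.
move=> /eqP pE; have qE : q = 2^-1 by lra.
by move=> A mA; rewrite halfE// -{2}qE -pE muE.
Qed.

End Optimality.

(** * Second moments of Gaussian variables *)

Section DensityBound.
Import HBNNSimple.
Local Open Scope ereal_scope.
Context d (T : measurableType d) (R : realType).
Variables (mu nu : {measure set T -> \bar R}) (rho : T -> R).
Hypothesis mrho : measurable_fun setT rho.
Hypothesis rho0 : forall x, (0 <= rho x)%R.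
Hypothesis nuE : forall A, measurable A -> nu A = \int[mu]_(x in A) (rho x)%:E.

Let integral_nnsfun_density (h : {nnsfun T >-> R}) :
  \int[nu]_x (h x)%:E = \int[mu]_x (h x * rho x)%:E.
Proof.
under [LHS]eq_integral do rewrite fimfunE -fsumEFin//.
rewrite [LHS]ge0_integral_fsum//; last 2 first.
  - by move=> r; exact/measurable_EFinP/measurableT_comp.
  - by move=> n x _; rewrite EFinM nnfun_muleindic_ge0.
under [RHS]eq_integral.
  move=> x xD; rewrite EFinM fimfunE -fsumEFin// muleC ge0_mule_fsumr; last first.
    by move=> r; rewrite EFinM nnfun_muleindic_ge0.
  over.
rewrite [RHS]ge0_integral_fsum//; last 2 first.
  - move=> r; apply/measurable_EFinP; apply: measurable_funM => //.
    by apply: measurable_funM.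
  - by move=> n x _; rewrite mule_ge0//; [rewrite lee_fin|rewrite EFinM nnfun_muleindic_ge0].
apply: eq_fsbigr => r _.
under [RHS]eq_integral do rewrite EFinM muleCA.
rewrite integralZl_indic_nnsfun//= integral_indic// setIT nuE//.
have [r0|r0] := leP 0%R r; last first.
  rewrite preimage_nnfun0// integral_set0 mule0.
  by under eq_integral do rewrite indic0 mule0 mule0; rewrite integral0.
rewrite ge0_integralZl//; last 2 first.
  - apply: emeasurable_funM; first exact/measurable_EFinP.
    exact/measurable_EFinP.
  - by move=> x _; rewrite mule_ge0// lee_fin.
congr (_ * _); rewrite integral_mkcond; apply: eq_integral => x _.
by rewrite patchE indicE; case: ifPn => _; rewrite ?mule1 ?mule0.
Qed.

(** An equality in fact; the upper bound suffices for finiteness of moments and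
    follows at once from the supremum over simple functions below [f]. *)
Lemma integral_density_le (f : T -> \bar R) :
  measurable_fun setT f -> (forall x, 0 <= f x) ->
  \int[nu]_x f x <= \int[mu]_x (f x * (rho x)%:E).
Proof.
move=> mf f0; rewrite ge0_integralTE//; apply: ge_ereal_sup => _ [h /= hf <-].
rewrite -integralT_nnsfun integral_nnsfun_density; apply: ge0_le_integral => //.
- by move=> x _; rewrite lee_fin mulr_ge0.
- by apply/measurable_EFinP/measurable_funM.
- by apply: emeasurable_funM => //; exact/measurable_EFinP.
- by move=> x _; rewrite EFinM lee_wpmul2r// lee_fin.
Qed.

End DensityBound.

Section GaussianMoment.
Context {R : realType}.

(** Doubling the standard deviation absorbs a square: with [y = x - m] and
    [z = 3 y^2 / (8 s^2)], the two exponentials differ by the factor [expR z],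
    which dominates [1 + z].  Finiteness of the second moment then follows from
    the density of parameter [2 s] having integral 1. *)
Lemma sqr_normal_pdf_le (m s x : R) : s != 0 ->
  x ^+ 2 * normal_pdf m s x <=
  (6 * s ^+ 2 + 2 * m ^+ 2) * normal_peak s / normal_peak (2 * s) *
    normal_pdf m (2 * s) x.
Proof.
move=> s0; have s20 : 2 * s != 0 by rewrite mulf_neq0.
have k0 := normal_peak_gt0 s20.
rewrite !normal_pdfE//= /normal_fun.
set p2 := normal_peak (2 * s); set p1 := normal_peak s.
rewrite [leRHS](_ : _ = p1 * ((6 * s ^+ 2 + 2 * m ^+ 2) *
    expR (- (x - m) ^+ 2 / ((2 * s) ^+ 2 *+ 2)))); last first.
  by field; rewrite gt_eqF.
rewrite mulrCA ler_wpM2l ?normal_peak_ge0//.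
have ss : 0 < s ^+ 2 by rewrite exprn_even_gt0.
set y := x - m; pose z := 3 / 8 * (y ^+ 2 / s ^+ 2).
have -> : - y ^+ 2 / ((2 * s) ^+ 2 *+ 2) = z + - y ^+ 2 / (s ^+ 2 *+ 2).
  by rewrite /z -mulr_natr -[s ^+ 2 *+ 2]mulr_natr; field.
rewrite expRD mulrA ler_wpM2r ?expR_ge0//.
have z0 : 0 <= z by rewrite mulr_ge0// divr_ge0 ?sqr_ge0.
have yz : y ^+ 2 = 8 / 3 * s ^+ 2 * z by rewrite /z; field.
have := expR_ge1Dx z => ez.
have x2 : x ^+ 2 <= 2 * y ^+ 2 + 2 * m ^+ 2.
  have -> : x = y + m by rewrite /y subrK.
  by have := sqr_ge0 (y - m); rewrite !expr2; nra.
have m2 := sqr_ge0 m.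
apply: (le_trans x2); rewrite yz.
have h1 : 0 <= (6 * s ^+ 2 + 2 * m ^+ 2) * (expR z - 1 - z).
  by rewrite mulr_ge0//; lra.
have h2 : 0 <= s ^+ 2 * z by rewrite mulr_ge0// ltW.
have h3 : 0 <= m ^+ 2 * z by rewrite mulr_ge0.
by lra.
Qed.

Lemma normal_prob_sqr_lty (m s : R) : s != 0 ->
  (\int[normal_prob m s]_x (x ^+ 2)%:E < +oo)%E.
Proof.
move=> s0; pose mu := @lebesgue_measure R.
have mX : measurable_fun [set: R] (fun x : R => x ^+ 2) by exact: exprn_measurable.
apply: (@le_lt_trans _ _ (\int[mu]_x ((x ^+ 2)%:E * (normal_pdf m s x)%:E))%E).
  apply: integral_density_le => //.
  - exact: measurable_normal_pdf.
  - by move=> x; exact: normal_pdf_ge0.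
  - exact/measurable_EFinP.
  - by move=> x; rewrite lee_fin sqr_ge0.
set C := (6 * s ^+ 2 + 2 * m ^+ 2) * normal_peak s / normal_peak (2 * s).
have C0 : 0 <= C.
  rewrite divr_ge0 ?normal_peak_ge0// mulr_ge0 ?normal_peak_ge0//.
  by rewrite addr_ge0// mulr_ge0// sqr_ge0.
apply: (@le_lt_trans _ _ (\int[mu]_x (C%:E * (normal_pdf m (2 * s) x)%:E))%E).
  apply: ge0_le_integral => //.
  - by move=> x _; rewrite mule_ge0// lee_fin ?sqr_ge0 ?normal_pdf_ge0.
  - by apply/measurable_EFinP/measurable_funM => //; exact: measurable_normal_pdf.
  - by apply/measurable_EFinP/measurable_funM => //; exact: measurable_normal_pdf.
  - by move=> x _; rewrite -!EFinM lee_fin sqr_normal_pdf_le.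
rewrite ge0_integralZl//.
- by rewrite integral_normal_pdf mule1 ltry.
- by apply/measurable_EFinP; exact: measurable_normal_pdf.
- by move=> x _; rewrite lee_fin normal_pdf_ge0.
Qed.

Context d (T : measurableType d) (P : probability T R).

Lemma Lfun2_sqr_lty (X : {RV P >-> R}) :
  (\int[P]_w (X w ^+ 2)%:E < +oo)%E -> (X : T -> R) \in Lfun P 2%:E.
Proof.
move=> X2; rewrite inE; apply/andP; split; first exact: mfunP.
rewrite inE/= /finite_norm unlock poweR_lty//.
apply: le_lt_trans X2; under eq_integral do
  rewrite /= powR_mulrn// -normrX ger0_norm ?sqr_ge0//.
by [].
Qed.

(** Borel sets of [R] come with two displays; [measurableTypeR R] is the one
    carrying Lebesgue, normal and Dirac measures. *)
Let toR (X : T -> R) : measurable_fun setT X ->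
  @measurable_fun _ _ T (measurableTypeR R) setT X.
Proof. by []. Qed.

Lemma integral_sqr_law (X : T -> R) (nu : {measure set (measurableTypeR R) -> \bar R}) :
  measurable_fun setT X ->
  (forall A : set (measurableTypeR R), measurable A -> P (X @^-1` A) = nu A) ->
  (\int[P]_w (X w ^+ 2)%:E = \int[nu]_x (x ^+ 2)%:E)%E.
Proof.
move=> /toR mX XE.
have msqr : measurable_fun [set: measurableTypeR R] (fun x : R => (x ^+ 2)%:E).
  by apply/measurable_EFinP; exact: exprn_measurable.
have <- := ge0_integral_pushforward mX P measurableT msqr (fun x _ => sqr_ge0 x).
by apply: eq_measure_integral => A mA _; exact: XE.
Qed.

Lemma gaussian_Lfun2 (X : {RV P >-> R}) :
  gaussian_rv P X -> (X : T -> R) \in Lfun P 2%:E.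
Proof.
move=> [m [s XE]]; apply: Lfun2_sqr_lty.
have mX : measurable_fun setT X by exact: measurable_funPT.
have [s0|s0] := eqVneq s 0.
  rewrite (integral_sqr_law (nu := @dirac _ (measurableTypeR R) m R))//.
    rewrite integral_dirac ?diracT ?mul1e ?ltry//.
    by apply/measurable_EFinP; exact: exprn_measurable.
  by move=> A mA; have := XE A mA; rewrite s0 eqxx.
rewrite (integral_sqr_law (nu := normal_prob m s))//.
  exact: normal_prob_sqr_lty.
by move=> A mA; have := XE A mA; rewrite (negbTE s0).
Qed.

End GaussianMoment.

(** * Covariance of the increment process *)

Section SecondMoments.
Context {R : realType} d (T : measurableType d) (P : probability T R).

Lemma eq_law_integral_sqr (X Z : T -> R) :
  measurable_fun setT X -> measurable_fun setT Z ->
  (forall A : set R, measurable A -> P (X @^-1` A) = P (Z @^-1` A)) ->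
  (\int[P]_w (X w ^+ 2)%:E = \int[P]_w (Z w ^+ 2)%:E)%E.
Proof.
move=> mX mZ XZ.
have mX' : @measurable_fun _ _ T (measurableTypeR R) setT X := mX.
have mZ' : @measurable_fun _ _ T (measurableTypeR R) setT Z := mZ.
have msqr : measurable_fun [set: measurableTypeR R] (fun x : R => (x ^+ 2)%:E).
  by apply/measurable_EFinP; exact: exprn_measurable.
have <- := ge0_integral_pushforward mX' P measurableT msqr (fun x _ => sqr_ge0 x).
have <- := ge0_integral_pushforward mZ' P measurableT msqr (fun x _ => sqr_ge0 x).
by apply: eq_measure_integral => A mA _; exact: XZ.
Qed.

(** The quadratic form is the second moment of [\sum_u u.1 * Z u.2]. *)
Lemma Rintegral_mul_psd (I : Type) (Z : I -> T -> R) (s : seq (R * I)) :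
  (forall i, Z i \in Lfun P 2%:E) ->
  0 <= \sum_(u <- s) \sum_(v <- s) u.1 * v.1 * \int[P]_w (Z u.2 w * Z v.2 w).
Proof.
move=> Z2.
have iZ i j : P.-integrable setT (EFin \o (fun w => Z i w * Z j w)).
  by apply/Lfun1_integrable; exact: Lfun2_mul_Lfun1.
have iZc (c : R) i j : P.-integrable setT (EFin \o (fun w => c * (Z i w * Z j w))).
  exact: (integrableZl _ c (iZ i j)).
have iZs (t : seq (R * I)) (u : R * I) :
    P.-integrable setT
      (EFin \o (fun w => \sum_(v <- t) (u.1 * v.1 * (Z u.2 w * Z v.2 w)))).
  rewrite (_ : _ \o _ =
      (fun w => \sum_(v <- t) (u.1 * v.1 * (Z u.2 w * Z v.2 w))%:E)%E).
    by apply: integrable_sum => // v _; exact: iZc.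
  by apply/funext => w /=; rewrite sumEFin.
have -> : \sum_(u <- s) \sum_(v <- s) u.1 * v.1 * \int[P]_w (Z u.2 w * Z v.2 w) =
    \int[P]_w (\sum_(u <- s) \sum_(v <- s) u.1 * v.1 * (Z u.2 w * Z v.2 w)).
  rewrite Rintegral_sum//; apply: eq_bigr => u _.
  by rewrite Rintegral_sum//; apply: eq_bigr => v _; rewrite RintegralZl.
apply: Rintegral_ge0 => w _.
rewrite [leRHS](_ : _ = (\sum_(u <- s) u.1 * Z u.2 w) ^+ 2) ?sqr_ge0//.
rewrite expr2 mulr_suml; apply: eq_bigr => u _.
by rewrite mulr_sumr; apply: eq_bigr => v _; ring.
Qed.

Variables (Y : R -> {RV P >-> R}) (h : R).
Hypothesis h_ge0 : 0 <= h.
Hypothesis Y_gaussian : gaussian_process Y.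
Hypothesis Y_centered : centered Y.
Hypothesis Y_stationary : stationary_increments Y.
Hypothesis Y_start : {ae P, forall w, Y 0 w = 0}.

Lemma gaussian_process_Lfun2 t : 0 <= t -> (Y t : T -> R) \in Lfun P 2%:E.
Proof.
move=> t0; apply: gaussian_Lfun2.
have := @Y_gaussian 1 (fun=> t) (fun=> 1) (fun=> t0).
by congr gaussian_rv; apply/funext => w; rewrite big_ord1 mul1r.
Qed.

Let Lfun2B (X Z : T -> R) : X \in Lfun P 2%:E -> Z \in Lfun P 2%:E ->
  X - Z \in Lfun P 2%:E.
Proof. by move=> X2 Z2; apply: rpredB => //; rewrite lee1n. Qed.

Let sqr_integrable (X : T -> R) : X \in Lfun P 2%:E ->
  P.-integrable setT (EFin \o (fun w => X w ^+ 2)).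
Proof. exact: Lfun2_integrable_sqr. Qed.

Lemma variance_functionE t : variance_function Y t = \int[P]_w (Y `|t| w ^+ 2).
Proof.
rewrite /variance_function /covariance_function covariance.unlock.
rewrite Y_centered//= expectation.unlock; congr fine.
by apply: eq_integral => w _; rewrite !fctE/= !subr0 expr2.
Qed.

Lemma variance_functionN t : variance_function Y (- t) = variance_function Y t.
Proof. by rewrite /variance_function normrN. Qed.

(** Stationarity gives the law of [Y q - Y p] from that of [Y (q - p) - Y 0]
    when [p <= q], and [Y 0] vanishes almost surely; evenness of the variance
    function covers the other case. *)
Lemma variogram p q : 0 <= p -> 0 <= q ->
  \int[P]_w ((Y q w - Y p w) ^+ 2) = variance_function Y (q - p).
Proof.
wlog pq : p q / p <= q.
  move=> wl p0 q0; have [pq|qp] := leP p q; first exact: wl.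
  rewrite -opprB variance_functionN -wl ?(ltW qp)//.
  by apply: eq_Rintegral => w _; rewrite -sqrrN opprB.
move=> p0 q0; have qp0 : 0 <= q - p by rewrite subr_ge0.
rewrite variance_functionE ger0_norm// /Rintegral; congr fine.
have mB s t : measurable_fun setT (fun w => Y s w - Y t w) by exact: measurable_funB.
transitivity (\int[P]_w ((Y (q - p) w - Y 0 w) ^+ 2)%:E)%E.
  apply: eq_law_integral_sqr => // A mA.
  have := @Y_stationary p 1 (fun=> q - p) (fun=> A) p0 (fun=> qp0) (fun=> mA).
  rewrite (addrC p) subrK.
  have cap (E : set T) : \bigcap_(i in [set: 'I_1]) E = E.
    by apply/seteqP; split => [w /(_ ord0)|w Ew i _] //; exact.
  by rewrite !cap.
apply: ae_eq_integral => //.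
- by apply/measurable_EFinP; apply: measurable_funX; exact: mB.
- by apply/measurable_EFinP; apply: measurable_funX; exact: measurable_funPT.
- by apply: filterS Y_start => w Y0 _; rewrite Y0 subr0.
Qed.

Lemma increment_process_Lfun2 t : 0 <= t -> increment_process h Y t \in Lfun P 2%:E.
Proof.
move=> t0; rewrite (_ : increment_process h Y t = (Y (t + h) : T -> R) - Y t)//.
by apply: Lfun2B; apply: gaussian_process_Lfun2; rewrite ?addr_ge0.
Qed.

(** Polarisation, 2 (A - B)(C - D) = (A - D)^2 + (C - B)^2 - (C - A)^2 - (D - B)^2,
    turns the covariance of increments into four values of the variance function;
    by its evenness they group into [f u + f (- u)] at [u = t - s]. *)
Lemma increment_covarianceE s t : 0 <= s -> 0 <= t ->
  increment_covariance h Y s t =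
  (increment_function h Y (t - s) + increment_function h Y (- (t - s))) / 2.
Proof.
move=> s0 t0.
have sh0 : 0 <= s + h by rewrite addr_ge0.
have th0 : 0 <= t + h by rewrite addr_ge0.
have iB p q : 0 <= p -> 0 <= q ->
    P.-integrable setT (EFin \o (fun w => (Y q w - Y p w) ^+ 2)).
  move=> p0 q0; apply: (@sqr_integrable ((Y q : T -> R) - Y p)).
  by apply: Lfun2B; exact: gaussian_process_Lfun2.
have iD p q p' q' : 0 <= p -> 0 <= q -> 0 <= p' -> 0 <= q' ->
    P.-integrable setT
      (EFin \o (fun w => (Y q w - Y p w) ^+ 2 + (Y q' w - Y p' w) ^+ 2)).
  by move=> ? ? ? ?; exact: (integrableD _ (iB _ _ _ _) (iB _ _ _ _)).
rewrite /increment_covariance expectation.unlock -/(Rintegral _ _ _).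
transitivity (\int[P]_w (2^-1 *
   (((Y (s + h) w - Y t w) ^+ 2 + (Y (t + h) w - Y s w) ^+ 2) -
    ((Y (t + h) w - Y (s + h) w) ^+ 2 + (Y t w - Y s w) ^+ 2)))).
  apply: eq_Rintegral => w _; rewrite /increment_process /=.
  by rewrite -[_ * _]/((Y (s + h) w - Y s w) * (Y (t + h) w - Y t w)); field.
rewrite RintegralZl//; last first.
  by apply: (integrableB _ (iD _ _ _ _ _ _ _ _) (iD _ _ _ _ _ _ _ _)).
rewrite RintegralB//; [|exact: iD|exact: iD].
rewrite !RintegralD//; try exact: iB.
rewrite !variogram// /increment_function.
rewrite (_ : s + h - t = - (t - s) + h); last by ring.
rewrite (_ : t + h - s = t - s + h); last by ring.
rewrite (_ : t + h - (s + h) = t - s); last by ring.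
by rewrite variance_functionN; field.
Qed.

Lemma increment_covariance_psd (s : seq (R * R)) :
  (forall u, u \in s -> 0 <= u.2) ->
  0 <= \sum_(u <- s) \sum_(v <- s) u.1 * v.1 * increment_covariance h Y u.2 v.2.
Proof.
move=> s0.
(* Square integrability is known at nonnegative times only, hence the absolute
   value in the family. *)
have := @Rintegral_mul_psd _ (fun x => increment_process h Y `|x|) s
  (fun x => increment_process_Lfun2 (normr_ge0 x)).
rewrite big_seq [in X in _ -> X]big_seq; congr (_ <= _); apply: eq_bigr => u us.
rewrite big_seq [RHS]big_seq; apply: eq_bigr => v vs.
rewrite !ger0_norm ?s0//; congr (_ * _).
by rewrite /increment_covariance expectation.unlock.
Qed.

End SecondMoments.

(** * The optimal measure *)

Lemma energy_ext (R : realType) (K K' : R -> R -> R) (a b : R)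
    (mu : probability (measurableTypeR R) R) :
  (forall s t, a <= s <= b -> a <= t <= b -> K s t = K' s t) ->
  energy K a b mu = energy K' a b mu.
Proof.
move=> KK'; apply: eq_integral => t /set_mem/=; rewrite in_itv/= => tab.
apply: eq_integral => s /set_mem/=; rewrite in_itv/= => sab.
by rewrite KK'.
Qed.

Lemma optimal_measure_ext (R : realType) (K K' : R -> R -> R) (a b : R) :
  (forall s t, a <= s <= b -> a <= t <= b -> K s t = K' s t) ->
  optimal_measure K a b = optimal_measure K' a b.
Proof.
move=> KK'; apply/funext => mu; rewrite /optimal_measure /optimal_value.
have -> : energy K a b = energy K' a b by apply/funext => nu; exact: energy_ext.
by [].
Qed.

Theorem theorem2p10 (R : realType) (d : measure_display) (T : measurableType d)
    (P : probability T R) (Y : R -> {RV P >-> R}) (h a b : R)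
    (h_gt0 : 0 < h)
    (Y_gaussian : gaussian_process Y)
    (Y_centered : centered Y)
    (Y_continuous : continuous_paths Y)
    (Y_stationary : stationary_increments Y)
    (Y_start : {ae P, forall w, Y 0 w = 0})
    (f_C2 : C2_on_positive (increment_function h Y))
    (f_increasing : positive_derivative (increment_function h Y))
    (f_concave : paired_concavity h (increment_function h Y))
    (a_ge0 : 0 <= a) (le_ab : a <= b) (ab_le_h : b - a <= h) :
  optimal_measure (increment_covariance h Y) a b (half_endpoints a b) /\
  forall mu : probability (measurableTypeR R) R,
    optimal_measure (increment_covariance h Y) a b mu ->
    forall A : set (measurableTypeR R), measurable A ->
      mu A = half_endpoints a b A.
Proof.
set f := increment_function h Y.
have h_ge0 := ltW h_gt0.
have fD t : derivable f t 1 by case: (f_increasing t).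
pose g u := (f u + f (- u)) / 2.
have KE s t : a <= s <= b -> a <= t <= b ->
    increment_covariance h Y s t = g (t - s).
  move=> /andP[as_ _] /andP[at_ _].
  by apply: increment_covarianceE => //; exact: le_trans a_ge0 _.
have fcont : continuous f.
  by move=> t; exact/differentiable_continuous/derivable1_diffP.
have gcont : continuous g.
  move=> u; apply: cvgM; last exact: cvg_cst.
  apply: cvgD; first exact: fcont.
  by apply: continuous_comp; [exact: opp_continuous|exact: fcont].
have geven u : g (- u) = g u by rewrite /g opprK addrC.
have gpsd (s : seq (R * R)) : (forall u, u \in s -> a <= u.2 <= b) ->
    0 <= \sum_(u <- s) \sum_(v <- s) u.1 * v.1 * g (u.2 - v.2).
  move=> sI; have sge0 u : u \in s -> 0 <= u.2.
    by move=> /sI/andP[au _]; exact: le_trans au.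
  have := increment_covariance_psd h_ge0 Y_gaussian sge0.
  rewrite big_seq [in X in _ -> X]big_seq; congr (_ <= _); apply: eq_bigr => u us.
  rewrite big_seq [RHS]big_seq; apply: eq_bigr => v vs.
  by rewrite KE ?sI// -geven opprB.
have gends x : a < x < b -> g 0 + g (b - a) < g (x - a) + g (b - x).
  move=> /andP[ax xb]; have -> : b - x = b - a - (x - a) by ring.
  apply: folded_sum_gt_ends => //; last by lra.
  move=> s /andP[s0 sL]; apply: f_concave => //; last by rewrite lt_eqF.
  by rewrite subr_ge0 le_ab.
rewrite (optimal_measure_ext KE); split.
  exact: half_endpoints_optimal.
move=> mu; exact: optimal_measure_unique.
Qed.
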